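(* Suppose there is a constant $l>0$ such that $d(X,Y)\le d(x,y)+l$ ($\mathbb P_{x,y}$-almost surely) for all $x,y\in S$. Suppose there are a nonnegative function $\Psi\in C([0,\infty))\cap C^2((0,\infty))$ with $\Psi(0)=0$, $\Psi'>0$, $\Psi''\le0$ and $\Psi''$ non-increasing on $(0,\infty)$, and constants $l_0,r_1,c_0>0$, with $r_1\ge l+1$, such that (b1) $\inf_{r\in(0,r_1]}\frac{\underline\alpha_{l_0}(r)}{r}>0$; (b2) $\Big[\sup_{r\in(0,r_1]}\frac{2\overline\beta(r)_+}{\Psi'(r+l_0)\underline\alpha_{l_0}(r)}+1\Big]\Psi(l_0)\le\log2$; (b3) $\overline\beta(r)\le-c_0r$ for all $r\in(r_1,\infty)$. Let $p>2$, $$c=\sup_{r\in(0,r_1]}\frac{2\overline\beta(r)_+}{\Psi'(r+l_0)\underline\alpha_{l_0}(r)}+1,\qquad k\ge1+\max\Big\{\frac{2le^{cl}}{c_0(r_1+l_0)},\frac{4^pl}{c_0(r_1+l_0)}\Big\},$$ $$A=\frac{(k(r_1+l_0))^{2-p}}{p(p-1)}\,c\,e^{-c(\Psi(r_1+l_0)+k(r_1+l_0))},$$ and define $$f_4(r)=\int_0^re^{-c\Psi(s)}\,ds\quad\text{for }0\le r\le r_1+l_0,$$ $$f_4(r)=f_4(r_1+l_0)+A(r-(r_1+l_0))^p+\frac1ce^{-c\Psi(r_1+l_0)}\big(1-e^{-c(r-(r_1+l_0))}\big)\quad\text{for }r>r_1+l_0.$$ Let $\rho(x,y)=f_4(d(x,y))$.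 Then there exists a constant $c_*\in(0,1)$ such that for all $x,y\in S$, $$\mathbb E_{x,y}[\rho(X,Y)]\le(1-c_* )\rho(x,y).$$
   Context: Let $(S,d)$ be a separable metric space and $p(x,dz)$ a Markov transition kernel on $S$ (the exponent $p>2$ in the claim is an unrelated real number). $((X,Y),\mathbb P_{x,y})$ is a Markov coupling of $p(x,\cdot)$ and $p(y,\cdot)$: there are random variables $X,Y:\Omega\to S$ on a common measurable space $(\Omega,\mathcal F)$ and probability measures $\mathbb P_{x,y}$ (depending on $(x,y)\in S\times S$ as a probability kernel) such that under $\mathbb P_{x,y}$, $X\sim p(x,\cdot)$ and $Y\sim p(y,\cdot)$. It is assumed that $\mathbb P_{x,x}(X=Y)=1$ for all $x\in S$. $\mathbb E_{x,y}$ is expectation under $\mathbb P_{x,y}$. For $x,y\in S$ and $l'\ge0$ put $\beta(x,y)=\mathbb E_{x,y}[d(X,Y)-d(x,y)]$, $\alpha_{l'}(x,y)=\frac12\mathbb E_{x,y}[(d(X,Y)-d(x,y))^2\mathbf 1_{\{d(X,Y)<d(x,y)+l'\}}]$. For $r>0$ put $\overline\beta(r)=\sup_{d(x,y)=r}\beta(x,y)$, $\underline\alpha_{l'}(r)=\inf_{d(x,y)=r}\alpha_{l'}(x,y)$, and $\overline\beta(r)_+=\max(\overline\beta(r),0)$. Values $r$ that are not attained as a distance are ignored in infima and suprema over $r$ (a supremum of nonnegative quantities over an empty set is $0$). *)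

(* Defs.v *)
From HB Require Import structures.
From mathcomp Require Import all_boot all_order all_algebra.
From mathcomp Require Import all_classical all_reals all_analysis.
Set Implicit Arguments.
Unset Strict Implicit.
Unset Printing Implicit Defensive.
Import Order.TTheory GRing.Theory Num.Theory.
Import numFieldNormedType.Exports.

Local Open Scope ring_scope.
Local Open Scope classical_set_scope.

(* [measurableType]s are pointed, so the state space has to be inhabited. *)
#[short(type="pmetricType")]
HB.structure Definition PMetric (K : numDomainType) :=
  {M of Pointed M & Metric K M}.

Definition separable (T : topologicalType) : Prop :=
  exists2 D : set T, countable D & dense D.

(* [S] with its Borel sigma-algebra.  The product [borel S * borel S] carries
   the product sigma-algebra, which is the Borel one when [S] is separable. *)
Notation borel S := (g_sigma_algebraType (@open S)).

Section coupling.
Context {R : realType} {S : pmetricType R} {d : measure_display}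
  {Omega : measurableType d}.
Variables (X Y : {mfun Omega >-> borel S})
  (P : R.-pker (borel S * borel S) ~> Omega).

Local Notation dist := (@mdist R S).

Definition markov_coupling (p : R.-pker borel S ~> borel S) : Prop :=
  forall (x y : S) (B : set (borel S)), measurable B ->
    pushforward (P (x, y)) X B = p x B /\ pushforward (P (x, y)) Y B = p y B.

Local Open Scope ereal_scope.

Definition beta (x y : S) : \bar R :=
  \int[P (x, y)]_w (dist (X w) (Y w) - dist x y)%:E.

Definition alpha (l' : R) (x y : S) : \bar R :=
  (2^-1)%:E * \int[P (x, y)]_w
    ((dist (X w) (Y w) - dist x y) ^+ 2 *
      \1_[set w' | (dist (X w') (Y w') < dist x y + l')%R] w)%:E.

Definition beta_sup (r : R) : \bar R :=
  ereal_sup [set beta xy.1 xy.2 | xy in [set xy | dist xy.1 xy.2 = r]].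

Definition alpha_inf (l' r : R) : \bar R :=
  ereal_inf [set alpha l' xy.1 xy.2 | xy in [set xy | dist xy.1 xy.2 = r]].

Definition distances (r1 : R) : set R :=
  [set r | (0 < r <= r1)%R /\ exists x y : S, dist x y = r].

Definition inf_alpha_ratio (l0 r1 : R) : \bar R :=
  ereal_inf [set alpha_inf l0 r / r%:E | r in distances r1].

(* The terms are nonnegative; [maxe 0] only makes the supremum over the empty
   set equal to [0] instead of [-oo]. *)
Definition sup_drift_ratio (Psi : R -> R) (l0 r1 : R) : \bar R :=
  maxe 0 (ereal_sup
    [set 2%:E * maxe (beta_sup r) 0 /
         ((derive1 Psi (r + l0))%:E * alpha_inf l0 r) | r in distances r1]).

End coupling.

(* The function [f_4], with [a] standing for [r_1 + l_0]. *)
Definition f4 {R : realType} (Psi : R -> R) (c A p a r : R) : R :=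
  let F t := \int[lebesgue_measure]_(s in `[0, t]) expR (- c * Psi s) in
  if r <= a then F r
  else F a + A * (r - a) `^ p
       + c^-1 * expR (- c * Psi a) * (1 - expR (- c * (r - a))).

(* Main.v *)
Require Import Defs.
From HB Require Import structures.
From mathcomp Require Import all_boot all_order all_algebra.
From mathcomp Require Import all_classical all_reals all_analysis.
From mathcomp Require Import measurable_realfun.
From mathcomp Require Import ring lra.
Set Implicit Arguments.
Unset Strict Implicit.
Unset Printing Implicit Defensive.
Import Order.TTheory GRing.Theory Num.Theory.
Import numFieldNormedType.Exports.

Local Open Scope ring_scope.
Local Open Scope classical_set_scope.

(** Write [r] for the distance before the step, [a] for [r1 + l0] and [f] for
    [f4].  Every estimate on the law of the new distance [d(X, Y)] is obtained
    from a bound of [f t - f r], valid for all [t] in [[0, r + l]], by an affine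
    function of [t - r], sometimes minus a multiple of
    [(t - r)^2 1_{t < r + l0}]: integrating such a bound replaces these
    expressions by the drift [beta] and the truncated variance [alpha]
    ([coupling_step]).  What is left is a deterministic study of [f].

    Up to [a] the slope of [f] is [e^{-c Psi}], which decreases; after [a] it is
    the sum of [A p (s - a)^(p-1)], which increases, and of a decreasing
    exponential.  The constant [A] is chosen so that the two second derivatives
    balance at [s - a = k a].  Hence [f] lies below its tangents on
    [[0, (1 + k) a]] ([f4_supergradient]), while the function [G] obtained by
    putting [A = 0] lies below its tangents on the whole half-line.

    If [0 < r <= r1], the new distance stays in the concave range, and below
    [r + l0] the tangent bound can be improved by half of
    [c Psi'(r + l0) e^{-c Psi(r + l0)}] times the squared increment, because
    [Psi'] decreases.  Subadditivity of [Psi] and [c Psi(l0) <= log 2] turn the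
    exponential into at least [e^{-c Psi(r)} / 2] ([f4_second_order]).  The
    definition of [c] makes the variance term beat the drift with a margin
    proportional to [alpha], which is at least a multiple of [r >= f(r)].

    If [r1 < r <= k a], the new distance is still in the concave range; the
    drift, at most [-c0 r], times the slope of [f], which is bounded below there
    by a positive constant, gives the contraction since [r >= f(r)].

    If [r > k a], write [f = G + h] with [h] equal to [A (s - a)^p] after [a]
    and to [0] before.  The tangent inequality and the negative drift show that
    [G] does not increase in mean.  Since [h] lies below its chord from [0] to
    [r + l], the mean of [h] is at most [(1 - c0) r / (r + l)] times
    [h(r + l)]; the size of [k] makes [h(r + l) <= e^{c0 / 2} h(r)], and
    [1 - c0 <= e^{-c0}], so that [h] contracts by the factor [e^{-c0 / 2}]
    ([f4_chord], [powR_excess]).  As [G] is bounded and [h] is bounded below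
    for such [r], a fixed fraction of [f = G + h] is lost. *)

(** * Functions lying below their tangents *)

(** Concavity is used only through this inequality.  Asking for a prescribed
    [D] instead of a derivative allows pieces to be glued at a point where [f]
    changes its formula. *)
Definition supergradient {R : realType} (D f : R -> R) (I : interval R) :=
  {in I &, forall s t, f t - f s <= D s * (t - s)}.

(** Add the inequality from [s] to [t] to the one from [t] to [s]. *)
Lemma supergradient_antitone {R : realType} (D f : R -> R) (I : interval R) :
  supergradient D f I -> {in I &, {homo D : s t /~ s <= t}}.
Proof.
move=> Df s t sI tI; rewrite le_eqVlt => /predU1P[->//|ts].
rewrite -(ler_pM2r (_ : 0 < s - t)) ?subr_gt0//.
have := Df _ _ sI tI; have := Df _ _ tI sI; lra.
Qed.

(** Mean value theorem: the increment is [t - s] times [D] at an intermediate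
    point, which monotonicity compares with [D s]. *)
Lemma supergradient_derive {R : realType} (D f : R -> R) (u v : R) :
    (forall x, x \in `]u, v[%R -> is_derive x 1 f (D x)) ->
    {within `[u, v], continuous f} ->
    {in `[u, v]%R &, {homo D : s t /~ s <= t}} ->
  supergradient D f `[u, v]%R.
Proof.
move=> fD fc Dle s t sI tI.
have inner x y : x \in `[u, v]%R -> y \in `[u, v]%R -> x < y ->
    exists2 z, z \in `]x, y[%R & f y - f x = D z * (y - x).
  move=> xI yI xy; have sub : `]x, y[ `<=` `]u, v[.
    by apply: subset_itv; [case/andP: xI|case/andP: yI].
  have fD' z : z \in `]x, y[%R -> is_derive z 1 f (D z) by move=> /sub; exact: fD.
  apply: (MVT xy fD'); apply: continuous_subspaceW fc.
  by apply: subset_itv; [case/andP: xI|case/andP: yI].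
have mid x y z : x \in `[u, v]%R -> y \in `[u, v]%R -> z \in `]x, y[%R ->
    z \in `[u, v]%R.
  rewrite !in_itv/= => /andP[ux _] /andP[_ yv] /andP[xz zy].
  by rewrite (le_trans ux (ltW xz)) (le_trans (ltW zy) yv).
have [st|ts|<-] := ltgtP s t; last by rewrite !subrr mulr0.
- have [z zst ->] := inner _ _ sI tI st.
  rewrite ler_pM2r ?subr_gt0//; apply: Dle => //; first exact: mid zst.
  by move: zst; rewrite in_itv/= => /andP[/ltW].
- have [z zst E] := inner _ _ tI sI ts.
  rewrite -lerN2 opprB E -mulrN opprB ler_pM2r ?subr_gt0//.
  apply: Dle => //; first exact: mid zst.
  by move: zst; rewrite in_itv/= => /andP[_ /ltW].
Qed.

(** When [s] and [t] are on both sides of [a], go through [a]: the two pieces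
    share the value [D a], which lies between [D s] and [D t]. *)
Lemma supergradient_glue {R : realType} (D f : R -> R) (u a v : R) :
    u <= a <= v ->
  supergradient D f `[u, a]%R -> supergradient D f `[a, v]%R ->
  supergradient D f `[u, v]%R.
Proof.
move=> /andP[ua av] L U s t.
rewrite !in_itv/= => /andP[us sv] /andP[ut tv].
have aL : a \in `[u, a]%R by rewrite in_itv/= ua lexx.
have aU : a \in `[a, v]%R by rewrite in_itv/= av lexx.
have [sa|/ltW as_] := leP s a; have [ta|/ltW at_] := leP t a.
- by apply: L; rewrite in_itv/= ?us ?ut.
- have sI : s \in `[u, a]%R by rewrite in_itv/= us.
  have tI : t \in `[a, v]%R by rewrite in_itv/= at_.
  have := ler_wpM2r (_ : 0 <= t - a) (supergradient_antitone L aL sI sa).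
  rewrite subr_ge0 at_ => /(_ isT).
  have := L _ _ sI aL; have := U _ _ aU tI; lra.
- have sI : s \in `[a, v]%R by rewrite in_itv/= as_.
  have tI : t \in `[u, a]%R by rewrite in_itv/= ut.
  have := ler_wpM2r (_ : 0 <= a - t) (supergradient_antitone U sI aU as_).
  rewrite subr_ge0 ta => /(_ isT).
  have := U _ _ sI aU; have := L _ _ aL tI; lra.
- by apply: U; rewrite in_itv/= ?as_ ?at_.
Qed.

Lemma antitone_derive {R : realType} (D dD : R -> R) (u v : R) :
    (forall x, x \in `]u, v[%R -> is_derive x 1 D (dD x)) ->
    (forall x, x \in `]u, v[%R -> dD x <= 0) ->
    {within `[u, v], continuous D} ->
  {in `[u, v]%R &, {homo D : s t /~ s <= t}}.
Proof.
move=> dDE dD0 Dc; apply: ler0_derive1_le_cc => // x xI.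
  by have /@ex_derive := dDE _ xI.
by rewrite derive1E (@derive_val _ _ _ _ _ _ _ (dDE _ xI)) dD0.
Qed.

(** The tangent at [0] bounds [f] from above, the tangent at [s], read at [0],
    from below. *)
Lemma supergradient_from0 {R : realType} (D f : R -> R) (b s : R) :
    supergradient D f `[0, b]%R -> f 0 = 0 -> D 0 = 1 -> 0 <= s <= b ->
  0 <= D s -> 0 <= f s <= s.
Proof.
move=> Df f0 D0 /andP[s0 sb] Ds.
have sI : s \in `[0, b]%R by rewrite in_itv/= s0.
have oI : 0 \in `[0, b]%R by rewrite in_itv/= lexx (le_trans s0).
have := Df _ _ sI oI; have := Df _ _ oI sI; have := mulr_ge0 Ds s0.
rewrite f0 D0; lra.
Qed.

(** * The primitive of the exponential profile *)

Lemma continuous_halfline_interior {R : realType} (h : R -> R) (x : R) :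
  {within `[0, +oo[, continuous h} -> 0 < x -> {for x, continuous h}.
Proof.
move=> hc x0; have : {within `]0, +oo[, continuous h}.
  by apply: continuous_subspaceW hc; apply: subset_itvr; rewrite bnd_simp.
rewrite continuous_open_subspace; last exact: interval_open.
by apply; rewrite inE/= in_itv/= x0.
Qed.

Lemma primitive_continuous {R : realType} (h : R -> R) (b : R) : 0 <= b ->
    {within `[0, +oo[, continuous h} ->
  {within `[0, b], continuous
    (fun t => \int[lebesgue_measure]_(s in `[0, t]) h s)}.
Proof.
move=> b0 hc; apply: (parameterized_integral_continuous b0).
apply: continuous_compact_integrable; first exact: segment_compact.
by apply: continuous_subspaceW hc; apply: subset_itvl.
Qed.

Lemma primitive_derive {R : realType} (h : R -> R) (x : R) : 0 < x ->
    {within `[0, +oo[, continuous h} ->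
  is_derive x 1 (fun t => \int[lebesgue_measure]_(s in `[0, t]) h s) (h x).
Proof.
move=> x0 hc.
have [] := @continuous_FTC1_closed R h 0 x (x + 1) _ _ x0.
- by rewrite ltrDl.
- apply: continuous_compact_integrable; first exact: segment_compact.
  by apply: continuous_subspaceW hc; apply: subset_itvl.
- exact: continuous_halfline_interior.
- by move=> dF eF; apply: DeriveDef; [exact: dF|rewrite -derive1E; exact: eF].
Qed.

Section profile.
Context {R : realType} (Psi : R -> R) (c : R).
Context (Psi_continuous : {within `[0, +oo[, continuous Psi}).
Context (Psi_derivable : forall r, 0 < r -> derivable Psi r 1).

Let F t := \int[lebesgue_measure]_(s in `[0, t]) expR (- c * Psi s).

Lemma expNPsi_continuous :
  {within `[0, +oo[, continuous (fun s => expR (- c * Psi s))}.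
Proof.
move=> x; apply: continuous_comp; last exact: continuous_expR.
by apply: continuousM; [exact: cst_continuous|exact: Psi_continuous].
Qed.

Lemma expNPsi_derive (x : R) : 0 < x ->
  is_derive x 1 (fun s => expR (- c * Psi s))
    (- (c * Psi^`()%classic x * expR (- c * Psi x))).
Proof.
move=> x0; have dPsi : is_derive x 1 Psi (Psi^`()%classic x).
  by apply: DeriveDef; [exact: Psi_derivable|rewrite derive1E].
have dM : is_derive x 1 (fun s => - c * Psi s) (- c * Psi^`()%classic x).
  by apply: is_derive_eq; rewrite /GRing.scale.
by apply: is_derive_eq; ring.
Qed.

(** Adding [K / 2 * t ^+ 2] to the primitive changes its slope into
    [expR (- c * Psi s) + K * s], which is still antitone when [K] is at most
    the decay rate of the exponential; the tangent inequality of this sum is the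
    claim.  The value [K = 0] gives plain concavity. *)
Lemma primitive_quadratic (K b : R) : 0 <= b ->
    (forall s, 0 < s < b -> K <= c * Psi^`()%classic s * expR (- c * Psi s)) ->
  {in `[0, b]%R &, forall s t,
    F t - F s <= expR (- c * Psi s) * (t - s) - K / 2 * (t - s) ^+ 2}.
Proof.
move=> b0 Kle.
have sg : supergradient (fun s => expR (- c * Psi s) + K * s)
    (fun t => F t + K / 2 * t ^+ 2) `[0, b]%R.
  apply: supergradient_derive.
  - move=> x; rewrite in_itv/= => /andP[x0 xb].
    have := primitive_derive x0 expNPsi_continuous => dF.
    by apply: is_derive_eq; rewrite /GRing.scale/=; field.
  - have cF : {within `[0, b], continuous F}.
      exact: primitive_continuous expNPsi_continuous.
    move=> x; apply: continuousD; first exact: cF.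
    apply: continuous_subspaceT => {}x.
    apply: (@continuous_comp _ _ _ (fun t : R => t ^+ 2)).
      exact: exprn_continuous.
    exact: mulrl_continuous.
  - apply: (@antitone_derive _ _
      (fun s => K - c * Psi^`()%classic s * expR (- c * Psi s))).
    + move=> x; rewrite in_itv/= => /andP[x0 xb].
      have dE := expNPsi_derive x0.
      by apply: is_derive_eq; rewrite /GRing.scale/=; ring.
    + move=> x; rewrite in_itv/= => xI; rewrite subr_le0; exact: Kle.
    + have cE : {within `[0, b], continuous (fun s => expR (- c * Psi s))}.
        by apply: continuous_subspaceW expNPsi_continuous; exact: subset_itvl.
      have cK : {within `[0, b], continuous ( *%R K)}.
        by apply: continuous_subspaceT; exact: mulrl_continuous.
      by move=> x; exact: (continuousD (cE x) (cK x)).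
move=> s t sI tI; have := sg s t sI tI; lra.
Qed.
End profile.

Lemma nondecreasing_derive {R : realType} (Psi : R -> R) (s t : R) :
    {within `[0, +oo[, continuous Psi} ->
    (forall r, 0 < r -> derivable Psi r 1) ->
    (forall r, 0 < r -> 0 <= Psi^`()%classic r) ->
  0 <= s -> s <= t -> Psi s <= Psi t.
Proof.
move=> Pc Pd P'0 s0 st.
have pos x : x \in `]s, t[%R -> 0 < x.
  by rewrite in_itv/= => /andP[sx _]; exact: le_lt_trans sx.
have dP x : x \in `]s, t[%R -> derivable Psi x 1 by move=> /pos; exact: Pd.
have dP0 x : x \in `]s, t[%R -> 0 <= Psi^`()%classic x.
  by move=> /pos; exact: P'0.
have cP : {within `[s, t], continuous Psi}.
  by apply: continuous_subspaceW Pc; apply: subset_itv; rewrite bnd_simp.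
have sI : s \in `[s, t]%R by rewrite in_itv/= st lexx.
have tI : t \in `[s, t]%R by rewrite in_itv/= st lexx.
exact: (ger0_derive1_le_cc dP dP0 cP sI tI st).
Qed.

Lemma derive_antitone {R : realType} (Psi : R -> R) :
    (forall r, 0 < r -> derivable Psi^`() r 1) ->
    (forall r, 0 < r -> Psi^`()^`() r <= 0) ->
  forall s t, 0 < s -> s <= t -> Psi^`()%classic t <= Psi^`()%classic s.
Proof.
move=> dPsi' Psi''_le0 s t s0 st.
have pos x : x \in `[s, t]%R -> 0 < x.
  by rewrite in_itv/= => /andP[sx _]; exact: lt_le_trans sx.
have posoo x : x \in `]s, t[%R -> 0 < x.
  by move=> /subset_itv_oo_cc; exact: pos.
have dd x : x \in `]s, t[%R ->
    is_derive x 1 Psi^`()%classic (Psi^`()^`()%classic x).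
  by move=> /posoo x0; apply: DeriveDef; [exact: dPsi'|rewrite derive1E].
have dd0 x : x \in `]s, t[%R -> Psi^`()^`()%classic x <= 0.
  by move=> /posoo; exact: Psi''_le0.
have cd : {within `[s, t], continuous Psi^`()%classic}.
  by apply: derivable_within_continuous => x /pos; exact: dPsi'.
have sI : s \in `[s, t]%R by rewrite in_itv/= st lexx.
have tI : t \in `[s, t]%R by rewrite in_itv/= st lexx.
exact: (antitone_derive dd dd0 cd tI sI st).
Qed.

(** By symmetry let [x <= y]; the increments of [Psi] over [[0, x]] and [[y, x + y]] have
    the same length, and the slope on the second interval is smaller. *)
Lemma concave_subadditive {R : realType} (Psi : R -> R) :
    {within `[0, +oo[, continuous Psi} -> Psi 0 = 0 ->
    (forall r, 0 < r -> derivable Psi r 1) ->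
    (forall s t, 0 < s -> s <= t -> Psi^`()%classic t <= Psi^`()%classic s) ->
  forall x y, 0 < x -> 0 < y -> Psi (x + y) <= Psi x + Psi y.
Proof.
move=> Pc P0 Pd Pa x y; wlog xy : x y / x <= y => [H|] x0 y0.
  have [/H|/ltW/H] := leP x y; first exact.
  by rewrite addrC (addrC (Psi x)); exact.
have dP (z : R) : 0 < z -> is_derive z 1 Psi (Psi^`()%classic z).
  by move=> z0; apply: DeriveDef; [exact: Pd|rewrite derive1E].
have cP (u v : R) : 0 <= u -> {within `[u, v], continuous Psi}.
  by move=> u0; apply: continuous_subspaceW Pc; apply: subset_itv; rewrite bnd_simp.
have yxy : y < x + y by rewrite ltrDr.
have dlo (z : R) : z \in `]0, x[%R -> is_derive z 1 Psi (Psi^`()%classic z).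
  by rewrite in_itv/= => /andP[z0 _]; exact: dP.
have dhi (z : R) : z \in `]y, (x + y)[%R -> is_derive z 1 Psi (Psi^`()%classic z).
  by rewrite in_itv/= => /andP[yz _]; apply: dP; exact: lt_trans yz.
have [e] := MVT x0 dlo (cP 0 x (lexx 0)).
rewrite in_itv/= P0 !subr0 => /andP[e0 ex] ->.
have [z] := MVT yxy dhi (cP y (x + y) (ltW y0)).
rewrite in_itv/= addrK => /andP[yz _] E.
rewrite -lerBlDr E ler_pM2r//; apply: Pa => //.
by rewrite (le_trans (ltW ex))// (le_trans xy)// ltW.
Qed.

(** * The function f4 and its slope *)

Lemma powR_continuous {R : realType} (q : R) : 0 < q ->
  {within `[0, +oo[, continuous (@powR R ^~ q)}.
Proof.
move=> q0; apply/continuous_within_itvcyP; split=> [x|].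
  rewrite in_itv/= andbT => x0.
  have := is_derive1_powR q x0.
  by move=> /@ex_derive/derivable1_diffP/differentiable_continuous.
rewrite powR0 ?gt_eqF//; exact: powR_cvg0.
Qed.

(** The condition on [A] and [B] says that the second derivative of the
    function is nonpositive. *)
Lemma tail_supergradient {R : realType} (A B c p U : R) :
    0 < c -> 2 < p ->
    (forall u, 0 < u < U ->
      A * p * (p - 1) * u `^ (p - 2) <= c * B * expR (- c * u)) ->
  supergradient (fun u => A * p * u `^ (p - 1) + B * expR (- c * u))
    (fun u => A * u `^ p + c^-1 * B * (1 - expR (- c * u))) `[0, U]%R.
Proof.
move=> c0 p2 ABle.
have powd (x q : R) : 0 < x -> is_derive x 1 (@powR R ^~ q) (q * x `^ (q - 1)).
  exact: is_derive1_powR.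
have powc (q : R) : 0 < q -> {within `[0, U], continuous (@powR R ^~ q)}.
  by move=> /powR_continuous; apply: continuous_subspaceW; exact: subset_itvl.
have expc : {within `[0, U], continuous (fun u => expR (- c * u))}.
  apply: continuous_subspaceT => x; apply: (@continuous_comp _ _ _ ( *%R (- c))).
    exact: mulrl_continuous.
  exact: continuous_expR.
have cstc (k : R) : {within `[0, U], continuous (fun=> k)}.
  by apply: continuous_subspaceT => x; exact: cst_continuous.
have Apc (k q : R) : 0 < q ->
    {within `[0, U], continuous (fun u => k * (u `^ q))}.
  move=> /powc qc x.
  exact: (continuousM (cstc k x) (qc x)).
have expd (x : R) : is_derive x 1 (fun u => expR (- c * u)) (- c * expR (- c * x)).
  have dM : is_derive x 1 (fun u => - c * u) (- c).
    by apply: is_derive_eq; rewrite /GRing.scale/= mulr1.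
  by apply: is_derive_eq; ring.
apply: supergradient_derive.
- move=> x; rewrite in_itv/= => /andP[x0 xU].
  have := powd x p x0; have := expd x => ? ?.
  apply: is_derive_eq; rewrite /GRing.scale/=.
  by field; rewrite gt_eqF.
- have pc : {within `[0, U], continuous (fun u => A * (u `^ p))}.
    by apply: Apc; lra.
  have ec : {within `[0, U], continuous (fun u => c^-1 * B * (1 - expR (- c * u)))}.
    move=> x.
    exact: (continuousM (cstc (c^-1 * B) x) (continuousB (cstc 1 x) (expc x))).
  by move=> x; exact: (continuousD (pc x) (ec x)).
- apply: (@antitone_derive _ (fun u => A * p * u `^ (p - 1) + B * expR (- c * u))
    (fun x => A * p * (p - 1) * x `^ (p - 2) - c * B * expR (- c * x))).
  + move=> x; rewrite in_itv/= => /andP[x0 xU].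
    have := powd x (p - 1) x0; have := expd x => ? ?.
    apply: is_derive_eq; rewrite /GRing.scale/=.
    by have -> : p - 1 - 1 = p - 2 by [ring]; ring.
  + by move=> x; rewrite in_itv/= => xI; rewrite subr_le0; exact: ABle.
  + have pc : {within `[0, U], continuous (fun u => A * p * (u `^ (p - 1)))}.
      by apply: Apc; lra.
    have ec : {within `[0, U], continuous (fun u => B * expR (- c * u))}.
      by move=> x; exact: (continuousM (cstc B x) (expc x)).
    by move=> x; exact: (continuousD (pc x) (ec x)).
Qed.

(** This [A] gives equality at [u = K]; for smaller [u] the power decreases and
    the exponential increases. *)
Lemma amplitude_tail {R : realType} (A c p K psi u : R) :
    0 < c -> 2 < p -> 0 < u < K ->
    A = K `^ (2 - p) / (p * (p - 1)) * c * expR (- c * (psi + K)) ->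
  A * p * (p - 1) * u `^ (p - 2) <= c * expR (- c * psi) * expR (- c * u).
Proof.
move=> c0 p2 /andP[u0 uK] ->; have K0 : 0 < K by exact: lt_trans uK.
have -> : K `^ (2 - p) / (p * (p - 1)) * c * expR (- c * (psi + K)) * p * (p - 1)
    * u `^ (p - 2) = c * expR (- c * psi) *
      ((K `^ (2 - p) * u `^ (p - 2)) * expR (- c * K)).
  rewrite (mulrDr (- c)) expRD; field; apply/andP; split; rewrite gt_eqF//; lra.
rewrite ler_pM2l ?mulr_gt0 ?expR_gt0//.
rewrite -[leRHS]mul1r ler_pM ?mulr_ge0 ?powR_ge0 ?expR_ge0//.
  rewrite -opprB powRN mulrC ler_pdivrMr ?powR_gt0//.
  by rewrite mul1r ge0_ler_powR ?nnegrE ?ltW//; lra.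
by rewrite ler_expR !mulNr lerN2 ler_pM2l// ltW.
Qed.

(** The derivative of [f4] on the positive half-line; for [1 < p] both branches
    take the value [expR (- c * Psi a)] at [s = a]. *)
Definition f4_slope {R : realType} (Psi : R -> R) (c A p a s : R) : R :=
  if s <= a then expR (- c * Psi s)
  else A * p * (s - a) `^ (p - 1) + expR (- c * Psi a) * expR (- c * (s - a)).

Lemma f4_le {R : realType} (Psi : R -> R) (c A p a s : R) : s <= a ->
  f4 Psi c A p a s =
    \int[lebesgue_measure]_(x in `[0, s]) expR (- c * Psi x).
Proof. by rewrite /f4 => ->. Qed.

Lemma f4_ge {R : realType} (Psi : R -> R) (c A p a s : R) : 0 < p -> a <= s ->
  f4 Psi c A p a s =
    \int[lebesgue_measure]_(x in `[0, a]) expR (- c * Psi x) +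
    A * (s - a) `^ p +
    c^-1 * expR (- c * Psi a) * (1 - expR (- c * (s - a))).
Proof.
move=> p0 as_; rewrite /f4; case: ifPn => // sa.
have -> : s = a by apply/le_anti; rewrite sa.
by rewrite subrr mulr0 expR0 subrr mulr0 powR0 ?gt_eqF// mulr0 !addr0.
Qed.

(** With amplitude [0] the power disappears; what remains is, for
    positive [c], bounded and concave on the whole half-line. *)
Lemma f4_split {R : realType} (Psi : R -> R) (c A p a s : R) : 0 < p ->
  f4 Psi c A p a s =
    f4 Psi c 0 p a s + (if s <= a then 0 else A * (s - a) `^ p).
Proof.
move=> p0; rewrite /f4; case: ifP => sa; first by rewrite addr0.
by rewrite mul0r addr0 addrAC.
Qed.

Lemma f4_slope_ge {R : realType} (Psi : R -> R) (c A p a s : R) : 1 < p ->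
    a <= s -> f4_slope Psi c A p a s =
  A * p * (s - a) `^ (p - 1) + expR (- c * Psi a) * expR (- c * (s - a)).
Proof.
move=> p1 as_; rewrite /f4_slope; case: ifPn => // sa.
have -> : s = a by apply/le_anti; rewrite sa.
by rewrite subrr mulr0 expR0 mulr1 powR0 ?mulr0 ?add0r// subr_eq0 gt_eqF.
Qed.

Lemma f4_0 {R : realType} (Psi : R -> R) (c A p a : R) : 0 <= a ->
  f4 Psi c A p a 0 = 0.
Proof. by move=> a0; rewrite f4_le// set_itv1 Rintegral_set1. Qed.

Lemma f4_slope_ge0 {R : realType} (Psi : R -> R) (c A p a s : R) :
  0 <= A -> 0 <= p -> 0 <= f4_slope Psi c A p a s.
Proof.
move=> A0 p0; rewrite /f4_slope; case: ifP => _; first exact: expR_ge0.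
by rewrite addr_ge0 ?mulr_ge0 ?powR_ge0 ?expR_ge0.
Qed.

(** The slope decreases on each side of [a] and both sides share its value at
    [a]; on the right, the hypothesis on [A] makes the second derivative at
    [a + u] nonpositive. *)
Lemma f4_supergradient {R : realType} (Psi : R -> R) (c A p a U : R) :
    {within `[0, +oo[, continuous Psi} ->
    (forall r, 0 < r -> derivable Psi r 1) ->
    (forall r, 0 < r -> 0 <= Psi^`()%classic r) ->
    0 < c -> 2 < p -> 0 <= a -> 0 <= U ->
    (forall u, 0 < u < U -> A * p * (p - 1) * u `^ (p - 2)
                            <= c * expR (- c * Psi a) * expR (- c * u)) ->
  supergradient (f4_slope Psi c A p a) (f4 Psi c A p a) `[0, a + U]%R.
Proof.
move=> Pc Pd P'0 c0 p2 a0 U0 tailU.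
apply: (@supergradient_glue _ _ _ 0 a); first by rewrite a0 lerDl.
- have sg := @primitive_quadratic R Psi c Pc Pd 0 a a0.
  move=> s t sI tI; have := sg _ s t sI tI.
  move: sI tI; rewrite !in_itv/= => /andP[_ sa] /andP[_ ta].
  rewrite !f4_le// /f4_slope sa mul0r mul0r subr0; apply => z /andP[z0 _].
  by rewrite mulr_ge0 ?expR_ge0// mulr_ge0 ?P'0// ltW.
- move=> s t; rewrite !in_itv/= => /andP[as_ sU] /andP[at_ tU].
  have sI : s - a \in `[0, U]%R by rewrite in_itv/= subr_ge0 as_ lerBlDl.
  have tI : t - a \in `[0, U]%R by rewrite in_itv/= subr_ge0 at_ lerBlDl.
  rewrite f4_slope_ge ?f4_ge//; try lra.
  have := tail_supergradient c0 p2 tailU sI tI; lra.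
Qed.

(** Amplitude [0] satisfies the smallness condition of [f4_supergradient] for
    every length of the interval. *)
Lemma capped_supergradient {R : realType} (Psi : R -> R) (c p a v : R) :
    {within `[0, +oo[, continuous Psi} ->
    (forall r, 0 < r -> derivable Psi r 1) ->
    (forall r, 0 < r -> 0 <= Psi^`()%classic r) ->
    0 < c -> 2 < p -> 0 <= a -> 0 <= v ->
  supergradient (f4_slope Psi c 0 p a) (f4 Psi c 0 p a) `[0, v]%R.
Proof.
move=> Pc Pd P'0 c0 p2 a0 v0 x y.
have sg : supergradient (f4_slope Psi c 0 p a) (f4 Psi c 0 p a) `[0, a + v]%R.
  apply: f4_supergradient => // u _.
  by rewrite !mul0r !mulr_ge0 ?expR_ge0// ltW.
have sub z : z \in `[0, v]%R -> z \in `[0, a + v]%R.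
  by rewrite !in_itv/= => /andP[-> zv]; rewrite (le_trans zv)// lerDr.
by move=> /sub xI /sub yI; exact: sg.
Qed.

Lemma capped_ge0 {R : realType} (Psi : R -> R) (c p a t : R) :
    {within `[0, +oo[, continuous Psi} -> Psi 0 = 0 ->
    (forall r, 0 < r -> derivable Psi r 1) ->
    (forall r, 0 < r -> 0 <= Psi^`()%classic r) ->
    0 < c -> 2 < p -> 0 <= a -> 0 <= t ->
  0 <= f4 Psi c 0 p a t.
Proof.
move=> Pc P0 Pd P'0 c0 p2 a0 t0.
have sg := capped_supergradient Pc Pd P'0 c0 p2 a0 t0.
have tI : 0 <= t <= t by rewrite t0 lexx.
have slope0 : f4_slope Psi c 0 p a 0 = 1.
  by rewrite /f4_slope a0 P0 mulr0 expR0.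
have p0 : 0 <= p by lra.
have Dt := f4_slope_ge0 Psi c a t (lexx 0) p0.
by have /andP[] := supergradient_from0 sg (f4_0 _ _ _ _ a0) slope0 tI Dt.
Qed.

(** The integral up to [a] contributes at most [a], the exponential at most
    [c^-1 <= 1]. *)
Lemma capped_le {R : realType} (Psi : R -> R) (c p a t : R) :
    {within `[0, +oo[, continuous Psi} -> Psi 0 = 0 ->
    (forall r, 0 < r -> derivable Psi r 1) ->
    (forall r, 0 < r -> 0 <= Psi^`()%classic r) ->
    1 <= c -> 2 < p -> 0 <= a -> a <= t ->
  f4 Psi c 0 p a t <= a + 1.
Proof.
move=> Pc P0 Pd P'0 c1 p2 a0 at_.
have c0 : 0 < c by lra.
have p0 : 0 < p by lra.
have Pa : 0 <= Psi a by rewrite -P0; exact: nondecreasing_derive.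
rewrite f4_ge// mul0r addr0 lerD//.
- rewrite -(f4_le Psi c 0 p (lexx a)).
  have aI : 0 <= a <= a by rewrite a0 lexx.
  have slope0 : f4_slope Psi c 0 p a 0 = 1.
    by rewrite /f4_slope a0 P0 mulr0 expR0.
  have sg := capped_supergradient Pc Pd P'0 c0 p2 a0 a0.
  have Da := f4_slope_ge0 Psi c a a (lexx 0) (ltW p0).
  by have /andP[] := supergradient_from0 sg (f4_0 _ _ _ _ a0) slope0 aI Da.
- have e1 : expR (- c * Psi a) <= 1.
    by rewrite -expR0 ler_expR mulNr oppr_le0 mulr_ge0// ltW.
  have e2 : 1 - expR (- c * (t - a)) <= 1 by rewrite gerBl expR_ge0.
  have e3 : 0 <= 1 - expR (- c * (t - a)).
    by rewrite subr_ge0 -expR0 ler_expR mulNr oppr_le0 mulr_ge0 ?subr_ge0// ltW.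
  have c1' : c^-1 <= 1 by rewrite invf_le1.
  have c2 : 0 <= c^-1 by rewrite invr_ge0 ltW.
  by rewrite mulr_ile1 ?mulr_ge0 ?expR_ge0// mulr_ile1 ?expR_ge0.
Qed.

Lemma f4_measurable {R : realType} (Psi : R -> R) (c A p a : R) :
    {within `[0, +oo[, continuous Psi} -> 0 <= a ->
  measurable_fun `[(0 : R), +oo[ (f4 Psi c A p a).
Proof.
move=> Pc a0; apply: measurable_fun_if => //.
- exact: measurable_fun_ler.
- apply: (@measurable_funS _ _ _ _ `[(0 : R), a]) => //.
    move=> x [/=]; rewrite !in_itv/= andbT => -> ->//.
  apply: subspace_continuous_measurable_fun => //.
  exact: (primitive_continuous a0 (expNPsi_continuous Pc)).
- apply: measurable_funTS.
  apply: measurable_funD.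
    apply: measurable_funD => //.
    apply: measurable_funM => //.
    apply: (@measurableT_comp _ _ _ _ _ _ (@powR R ^~ p)) => //.
    exact: measurable_funB.
  apply: measurable_funM => //.
  apply: measurable_funB => //.
  apply: (@measurableT_comp _ _ _ _ _ _ (@expR R)) => //.
  apply: measurable_funM => //.
  exact: measurable_funB.
Qed.

(** * Bounds of f4 after a step *)

(** Only increments towards points below [r + l0] get the quadratic
    improvement.  On [[0, r + l0]] the constant
    [c * Psi'(r + l0) * expR (- c * Psi (r + l0))] is a lower bound of the decay
    rate of the slope, and it is at least
    [c * Psi'(r + l0) * expR (- c * Psi r) / 2] since
    [c * Psi (r + l0) <= c * Psi r + ln 2]. *)
Lemma f4_second_order {R : realType} (Psi : R -> R) (c A p a b l0 r t : R) :
    {within `[0, +oo[, continuous Psi} -> Psi 0 = 0 ->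
    (forall r, 0 < r -> derivable Psi r 1) ->
    (forall r, 0 < r -> 0 < Psi^`()%classic r) ->
    (forall s t, 0 < s -> s <= t -> Psi^`()%classic t <= Psi^`()%classic s) ->
    0 < c -> 0 < l0 -> c * Psi l0 <= ln 2 -> 0 < r -> r + l0 <= a -> r <= b ->
    supergradient (f4_slope Psi c A p a) (f4 Psi c A p a) `[0, b]%R ->
    0 <= t <= b ->
  f4 Psi c A p a t <= f4 Psi c A p a r + expR (- c * Psi r) * (t - r)
    - expR (- c * Psi r) * c * Psi^`()%classic (r + l0) / 2 *
      (2^-1 * ((t - r) ^+ 2 * (t < r + l0)%R%:R)).
Proof.
move=> Pc P0 Pd P'0 Pa c0 l00 cPl0 r0 rl0a rb sg /andP[t0 tb].
have rl0 : 0 < r + l0 by lra.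
case: ltP => [trl0|_]; last first.
  have := sg r t; rewrite !in_itv/= (ltW r0) rb t0 tb => /(_ isT isT).
  by rewrite /f4_slope (_ : r <= a); lra.
set e := expR (- c * Psi r); set m := Psi^`()%classic (r + l0).
have m0 : 0 < m by exact: P'0.
have e0 : 0 < e by exact: expR_gt0.
pose K := c * m * expR (- c * Psi (r + l0)).
have KE : c * m * (e / 2) <= K.
  rewrite /K ler_pM2l ?mulr_gt0//.
  rewrite -[2]lnK ?posrE// -expRN /e -expRD ler_expR.
  have := concave_subadditive Pc P0 Pd Pa r0 l00.
  rewrite -(ler_pM2l c0); lra.
have Kle s : 0 < s < r + l0 -> K <= c * Psi^`()%classic s * expR (- c * Psi s).
  move=> /andP[s0 /ltW srl0]; rewrite /K ler_pM ?expR_ge0//.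
  - by rewrite mulr_ge0 ?ltW.
  - by rewrite ler_pM2l// Pa.
  - rewrite ler_expR !mulNr lerN2 ler_pM2l//.
    by apply: nondecreasing_derive => //; [move=> z /P'0/ltW|exact: ltW].
have rI : r \in `[0, r + l0]%R by rewrite in_itv/=; lra.
have tI : t \in `[0, r + l0]%R by rewrite in_itv/=; lra.
have := primitive_quadratic Pc Pd (ltW rl0) Kle rI tI.
rewrite !f4_le -/e; try lra.
have := ler_wpM2r (_ : 0 <= (t - r) ^+ 2) KE; rewrite sqr_ge0 => /(_ isT).
by rewrite mulr1; lra.
Qed.

(** [t - a <= t / v * (v - a)], and a power of exponent at least [1] of
    [t / v <= 1] is at most [t / v]. *)
Lemma powR_chord {R : realType} (p a t v : R) : 1 <= p -> 0 <= a ->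
  a <= t -> t <= v -> 0 < v -> (t - a) `^ p <= t / v * (v - a) `^ p.
Proof.
move=> p1 a0 at_ tv v0.
have t0 : 0 <= t by exact: le_trans at_.
have tv0 : 0 <= t / v by rewrite divr_ge0// ltW.
have tv1 : t / v <= 1 by rewrite ler_pdivrMr// mul1r.
have : (t - a) `^ p <= (t / v * (v - a)) `^ p.
  rewrite ge0_ler_powR ?nnegrE ?(le_trans _ p1)//; first by rewrite subr_ge0.
    by rewrite mulr_ge0// subr_ge0 (le_trans at_).
  rewrite mulrBr divfK ?gt_eqF// lerB//.
  by rewrite -[leRHS]mul1r ler_wpM2r.
move=> /le_trans; apply; rewrite powRM ?subr_ge0 ?(le_trans at_)//.
rewrite ler_wpM2r ?powR_ge0//.
have [->|tvn0] := eqVneq (t / v) 0.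
  by rewrite powR0// gt_eqF// (lt_le_trans _ p1).
by rewrite ge1r_powR// lt_neqAle eq_sym tvn0 tv0.
Qed.

(** Tangent inequality for the bounded part, chord through [0] and [v] for the
    power; the right-hand side is affine in [t], so that only the drift enters
    its expectation. *)
Lemma f4_chord {R : realType} (Psi : R -> R) (c A p a r v t : R) :
    0 <= A -> 1 <= p -> 0 <= a -> 0 <= r <= v -> 0 < v ->
    supergradient (f4_slope Psi c 0 p a) (f4 Psi c 0 p a) `[0, v]%R ->
    0 <= t <= v ->
  f4 Psi c A p a t <=
    (f4 Psi c 0 p a r + r / v * (A * (v - a) `^ p))
    + (f4_slope Psi c 0 p a r + (A * (v - a) `^ p) / v) * (t - r).
Proof.
move=> A0 p1 a0 rI v0 sg tI; have p0 : 0 < p by lra.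
have {sg} := sg r t; rewrite !in_itv/= => /(_ rI tI) sg.
have {rI} /andP[r0 rv] := rI; have {tI} /andP[t0 tv] := tI.
set H := A * (v - a) `^ p.
have extra : (if t <= a then 0 else A * (t - a) `^ p) <= t / v * H.
  have H0 : 0 <= H by rewrite mulr_ge0 ?powR_ge0.
  case: (leP t a) => [_|/ltW at_]; first by rewrite mulr_ge0// divr_ge0// ltW.
  by rewrite /H mulrCA ler_wpM2l// powR_chord.
rewrite (f4_split _ _ A)//.
have -> : f4 Psi c 0 p a r + r / v * H
    + (f4_slope Psi c 0 p a r + H / v) * (t - r) =
    f4 Psi c 0 p a r + f4_slope Psi c 0 p a r * (t - r) + t / v * H by ring.
by rewrite lerD// -lerBlDl.
Qed.

(** With [d = c0 / (2 * p)], the hypothesis gives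
    [q + l <= q * (1 + d) <= q * expR d] because [2 * p <= 4 `^ p]; raising to the
    power [p] costs a factor [expR (c0 / 2)], and [1 - c0 <= expR (- c0)]. *)
Lemma powR_excess {R : realType} (p q l c0 : R) : 2 < p -> 0 < c0 -> 0 <= l ->
    0 <= q -> 4 `^ p * l <= c0 * q ->
  (1 - c0) * (q + l) `^ p <= expR (- (c0 / 2)) * q `^ p.
Proof.
move=> p2 c00 l0 q0 lq.
have p0 : 0 < p by lra.
have p4 : 2 * p <= 4 `^ p.
  (* Square [expR (- 1 / 2) >= 1 / 2] and invert. *)
  have e4 : expR 1 <= 4 :> R.
    have h2 : 2^-1 <= expR (- 2^-1) :> R.
      by have := expR_ge1Dx (- 2^-1 : R); lra.
    have E : expR 1 * (expR (- 2^-1) * expR (- 2^-1)) = 1 :> R.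
      by rewrite -!expRD -[RHS]expR0; congr expR; field.
    have : 4^-1 <= expR (- 2^-1) * expR (- 2^-1) :> R.
      by rewrite (_ : 4^-1 = 2^-1 * 2^-1 :> R) ?ler_pM//; field.
    by rewrite -(ler_pM2l (expR_gt0 1)) E; lra.
  have : expR (p / 2) ^+ 2 <= 4 `^ p.
    rewrite -expRM_natl mulrC divfK// -[p in expR p]mul1r expRM.
    by rewrite ge0_ler_powR ?nnegrE ?expR_ge0// ltW.
  apply: le_trans; have := expR_ge1Dx (p / 2) => e1.
  (* [2 * p <= (1 + p / 2) ^+ 2], the difference being a square. *)
  have : (1 + p / 2) ^+ 2 <= expR (p / 2) ^+ 2.
    by rewrite lerXn2r// nnegrE; [lra|exact: expR_ge0].
  by have := sqr_ge0 (1 - p / 2); lra.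
have P0 : 0 < 4 `^ p :> R by exact: powR_gt0.
pose d := c0 / (2 * p).
have ql : q + l <= q * expR d.
  have : l <= q * d.
    rewrite /d mulrA ler_pdivlMr ?mulr_gt0//.
    by rewrite (le_trans (ler_wpM2l l0 p4))// mulrC (mulrC q).
  have := ler_wpM2l q0 (expR_ge1Dx d); lra.
have le1 : (q + l) `^ p <= q `^ p * expR (c0 / 2).
  have : (q + l) `^ p <= (q * expR d) `^ p.
    by rewrite ge0_ler_powR ?nnegrE ?addr_ge0 ?mulr_ge0 ?expR_ge0// ltW.
  rewrite powRM ?expR_ge0// -expRM (_ : d * p = c0 / 2)//.
  by rewrite /d; field; rewrite gt_eqF.
have e1 : 1 - c0 <= expR (- c0) by exact: expR_ge1Dx.
apply: le_trans (ler_wpM2r (powR_ge0 _ _) e1) _.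
apply: le_trans (ler_wpM2l (expR_ge0 _) le1) _.
rewrite mulrCA -expRD mulrC (_ : - c0 + c0 / 2 = - (c0 / 2))//; last by field.
Qed.

(** * From pointwise bounds to expectations *)

Lemma mdist_ball_open {R : realType} {S : pmetricType R} (q : S) (e : R) :
  open (ball q e).
Proof.
rewrite openE ballEmdist => x /= qx; apply/nbhs_ballP.
exists (e - mdist q x) => /=; first by rewrite subr_gt0.
move=> y; rewrite ballEmdist/= => xy.
have := metric_triangle q x y; lra.
Qed.

(** The Borel sets of the square of [S] enter only through the product
    sigma-algebra, so continuity of the distance is not enough: the sublevel
    sets are written as unions, over a countable dense set, of the sets where
    the distances to a fixed point add up to less than the level. *)
Lemma measurable_mdist {R : realType} {S : pmetricType R}
    {d : measure_display} {T : measurableType d} (X Y : {mfun T >-> borel S}) :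
  separable S -> measurable_fun setT (fun w => @mdist R S (X w) (Y w)).
Proof.
move=> [D cD dD] _.
have mq (Z : {mfun T >-> borel S}) (q : S) :
    measurable_fun setT (fun w => @mdist R S (Z w) q).
  move=> mT; apply: (measurability _ (RGenInftyO.measurableE R)) => // _ [_ [e ->] <-].
  rewrite setTI.
  have -> : (fun w => @mdist R S (Z w) q) @^-1` `]-oo, e[ =
      Z @^-1` ball q e.
    by rewrite ballEmdist; apply/seteqP; split => w /=; rewrite in_itv/= metric_sym.
  rewrite -[X in measurable X]setTI; apply: measurable_funP => //.
  by apply: sub_sigma_algebra; exact: mdist_ball_open.
apply: (measurability _ (RGenInftyO.measurableE R)) => // _ [_ [e ->] <-].
rewrite setTI.
have -> : (fun w => @mdist R S (X w) (Y w)) @^-1` `]-oo, e[ =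
    \bigcup_(q in D) [set w | mdist (X w) q + mdist (Y w) q < e].
  apply/seteqP; split => w /=; rewrite in_itv/=.
  - move=> wlt.
    have e0 : 0 < (e - mdist (X w) (Y w)) / 2 by rewrite divr_gt0// subr_gt0.
    have B0 : @ball R S (X w) ((e - mdist (X w) (Y w)) / 2) !=set0.
      by exists (X w); apply: ballxx e0.
    have [q [Xq Dq]] := dD _ B0 (mdist_ball_open (X w) _).
    move: Xq; rewrite ballEmdist/= => Xq; exists q => //=.
    have := metric_triangle (Y w) (X w) q; rewrite (metric_sym (Y w) (X w)).
    by move: Xq; lra.
  - move=> [q _ /=]; have := metric_triangle (X w) q (Y w).
    by rewrite (metric_sym q); lra.
have mF q : measurable [set w | mdist (X w) q + mdist (Y w) q < e].
  have -> : [set w | mdist (X w) q + mdist (Y w) q < e] =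
      (fun w => mdist (X w) q + mdist (Y w) q) @^-1` `]-oo, e[.
    by apply/seteqP; split => w /=; rewrite in_itv.
  rewrite -[X in measurable X]setTI.
  by apply: measurable_funD => //; exact: mq.
have [->|[g]] := pfcard_geP cD; first by rewrite bigcup_set0.
rewrite -(image_eq g) bigcup_image.
exact: bigcup_measurable.
Qed.

(** The lower bound [0 <= f] makes [f] of [Z] integrable, being dominated by the
    right-hand side, which is bounded because [Z] is. *)
Lemma integral_le_moments {R : realType} {d : measure_display}
    {T : measurableType d} (mu : {measure set T -> \bar R}) (Z : T -> R) (f : R -> R)
    (r s M u v w : R) :
    mu setT = 1%E ->
    measurable_fun setT Z -> measurable_fun `[(0 : R), +oo[ f ->
    (forall x, 0 <= Z x <= M) ->
    (forall t, 0 <= t <= M -> 0 <= f t) ->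
    (forall t, 0 <= t <= M ->
      f t <= w + u * (t - r)
             - v * (2^-1 * ((t - r) ^+ 2 * (t < s)%R%:R))) ->
  exists b a : R, [/\
    (\int[mu]_x (Z x - r)%:E)%E = b%:E,
    (2^-1%:E * \int[mu]_x ((Z x - r) ^+ 2 * \1_[set y | Z y < s] x)%:E)%E = a%:E &
    (\int[mu]_x (f (Z x))%:E <= (w + u * b - v * a)%:E)%E].
Proof.
move=> mu1 mZ mf ZM f0 fle.
have mZr : measurable_fun setT (fun x => Z x - r) by exact: measurable_funB.
have mI : measurable_fun setT (\1_[set y | Z y < s] : T -> R).
  apply: measurable_indic.
  have -> : [set y | Z y < s] = Z @^-1` `]-oo, s[.
    by apply/seteqP; split => x /=; rewrite in_itv.
  by rewrite -[X in measurable X]setTI; exact: mZ.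
have mQ : measurable_fun setT
    (fun x => (Z x - r) ^+ 2 * \1_[set y | Z y < s] x).
  by apply: measurable_funM => //; exact: measurable_funX.
have muT : (mu setT < +oo)%E by rewrite mu1 ltry.
have iZ : mu.-integrable setT (EFin \o (fun x => Z x - r)).
  apply: measurable_bounded_integrable => //.
  exists (M + `|r|); split; first exact: num_real.
  move=> K MK x _; have /andP[Z0 ZleM] := ZM x.
  apply: le_trans (ltW MK); rewrite (le_trans (ler_normB _ _))//.
  by rewrite ger0_norm// lerD2r.
have iQ : mu.-integrable setT
    (EFin \o (fun x => (Z x - r) ^+ 2 * \1_[set y | Z y < s] x)).
  apply: measurable_bounded_integrable => //.
  exists ((M + `|r|) ^+ 2); split; first exact: num_real.
  move=> K MK x _; have /andP[Z0 ZleM] := ZM x.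
  apply: le_trans (ltW MK); rewrite normrM normrX -[leRHS]mulr1 ler_pM//.
    rewrite lerXn2r ?nnegrE//; first by rewrite addr_ge0// (le_trans Z0).
    rewrite (le_trans (ler_normB _ _))//.
    by rewrite ger0_norm// lerD2r.
  by rewrite indicE normr_nat lern1 leq_b1.
exists (\int[mu]_x (Z x - r))%R.
exists (2^-1 * \int[mu]_x ((Z x - r) ^+ 2 * \1_[set y | Z y < s] x))%R.
split.
- by rewrite /Rintegral fineK//; exact: integrable_fin_num.
- by rewrite /Rintegral EFinM fineK//; exact: integrable_fin_num.
pose g x := w + u * (Z x - r)
  - v * (2^-1 * ((Z x - r) ^+ 2 * \1_[set y | Z y < s] x)).
have iuZ : mu.-integrable setT (EFin \o (fun x => u * (Z x - r))).
  exact: (integrableZl measurableT u iZ).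
have ivQ : mu.-integrable setT (EFin \o (fun x =>
    v * (2^-1 * ((Z x - r) ^+ 2 * \1_[set y | Z y < s] x)))).
  exact: (integrableZl measurableT v (integrableZl measurableT 2^-1 iQ)).
have iw : mu.-integrable setT (EFin \o (fun=> w)).
  apply: measurable_bounded_integrable => //.
  exists `|w|; split; first exact: num_real.
  by move=> K /ltW wK z _.
have iwu : mu.-integrable setT (EFin \o (fun x => w + u * (Z x - r))).
  exact: (integrableD measurableT iw iuZ).
have ig : mu.-integrable setT (EFin \o g).
  exact: (integrableB measurableT iwu ivQ).
have fg x : 0 <= f (Z x) <= g x.
  rewrite f0//=; apply: le_trans (fle _ (ZM x)) _.
  by rewrite /g indicE mem_setE.
have mfZ : measurable_fun setT (f \o Z).
  apply: measurable_comp mf mZ => //.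
  by move=> _ [x _ <-] /=; rewrite in_itv/= andbT; have /andP[] := ZM x.
have ifZ : mu.-integrable setT (EFin \o (f \o Z)).
  apply: le_integrable ig => //; first exact/measurable_EFinP.
  move=> x _ /=; rewrite lee_fin; have /andP[fx0 fxg] := fg x.
  by rewrite !ger0_norm// (le_trans fx0).
have -> : (w + u * \int[mu]_x (Z x - r)
   - v * (2^-1 * \int[mu]_x ((Z x - r) ^+ 2 * \1_[set y | Z y < s] x)))%R
   = \int[mu]_x g x.
  rewrite /g (RintegralB measurableT iwu ivQ) (RintegralD measurableT iw iuZ).
  rewrite (RintegralZl u measurableT iZ) (Rintegral_cst _ measurableT).
  rewrite (RintegralZl v measurableT (integrableZl measurableT 2^-1 iQ)).
  rewrite (RintegralZl 2^-1 measurableT iQ); congr (_ + _ - _).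
  by rewrite -[LHS]mulr1; congr (_ * _); rewrite mu1.
rewrite /Rintegral fineK; last exact: integrable_fin_num.
apply: le_integral => // x _; rewrite lee_fin.
by have /andP[] := fg x.
Qed.

(** The new distance is replaced by its minimum with [mdist x y + l], which is
    almost surely the same and is bounded everywhere. *)
Lemma coupling_step {R : realType} {S : pmetricType R} {d : measure_display}
    {Omega : measurableType d} (X Y : {mfun Omega >-> borel S})
    (P : R.-pker (borel S * borel S) ~> Omega) (x y : S) (f : R -> R)
    (l l0 u v w : R) :
    separable S ->
    {ae P (x, y), forall z, @mdist R S (X z) (Y z) <= mdist x y + l} ->
    0 <= l ->
    measurable_fun `[(0 : R), +oo[ f ->
    (forall t, 0 <= t <= mdist x y + l -> 0 <= f t) ->
    (forall t, 0 <= t <= mdist x y + l ->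
      f t <= w + u * (t - mdist x y)
        - v * (2^-1 * ((t - mdist x y) ^+ 2 * (t < mdist x y + l0)%R%:R))) ->
  exists b a : R, [/\ beta X Y P x y = b%:E, alpha X Y P l0 x y = a%:E &
    (\int[P (x, y)]_z (f (@mdist R S (X z) (Y z)))%:E
      <= (w + u * b - v * a)%:E)%E].
Proof.
move=> sS jump l_ge0 mf f0 fle.
set r := mdist x y in jump f0 fle *.
have mD := measurable_mdist X Y sS.
pose Z z := Num.min (@mdist R S (X z) (Y z)) (r + l).
have mZ : measurable_fun setT Z by exact: measurable_minr.
have r0 : 0 <= r by exact: mdist_ge0.
have ZM z : 0 <= Z z <= r + l.
  by rewrite le_min mdist_ge0 addr_ge0//= ge_min lexx orbT.
have P1 := @prob_kernel _ _ _ _ _ P (x, y).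
have [b [a [Eb Ea Ef]]] := integral_le_moments P1 mZ mf ZM f0 fle.
have ZE (h : R -> R) : measurable_fun setT (fun z => h (Z z)) ->
    measurable_fun setT (fun z => h (@mdist R S (X z) (Y z))) ->
    (\int[P (x, y)]_z (h (@mdist R S (X z) (Y z)))%:E =
     \int[P (x, y)]_z (h (Z z))%:E)%E.
  move=> mhZ mhD; apply: ae_eq_integral => //; try exact/measurable_EFinP.
  by apply: filterS jump => z zle _; rewrite /Z min_l.
have mS (V : Omega -> R) : measurable_fun setT V ->
    measurable_fun setT (fun z => (V z - r) ^+ 2 * (V z < r + l0)%R%:R).
  move=> mV.
  have -> : (fun z => (V z - r) ^+ 2 * (V z < r + l0)%R%:R) =
      (fun z => (V z - r) ^+ 2 * \1_[set z | V z < r + l0] z).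
    by apply/funext => z; rewrite indicE mem_setE.
  apply: measurable_funM; first by apply: measurable_funX; exact: measurable_funB.
  apply: measurable_indic.
  have -> : [set z | V z < r + l0] = V @^-1` `]-oo, r + l0[.
    by apply/seteqP; split => z /=; rewrite in_itv.
  by rewrite -[X in measurable X]setTI; exact: mV.
have mfV (V : Omega -> R) : measurable_fun setT V -> (forall z, 0 <= V z) ->
    measurable_fun setT (fun z => f (V z)).
  move=> mV V0; apply: measurable_comp mf mV => //.
  by move=> _ [z _ <-] /=; rewrite in_itv/= andbT.
have Z0 z : 0 <= Z z by have /andP[] := ZM z.
exists b, a; split.
- by rewrite -Eb /beta; apply: (ZE (fun t => t - r)); exact: measurable_funB.
- rewrite -Ea /alpha; congr (_ * _)%E.
  have := ZE (fun t => (t - r) ^+ 2 * (t < r + l0)%R%:R) (mS _ mZ) (mS _ mD).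
  move=> H; apply: eq_trans (eq_trans H _); apply: eq_integral => z _.
    by rewrite indicE mem_setE.
  by rewrite indicE mem_setE.
- rewrite (ZE f) //; apply: mfV => //.
  by move=> z; exact: mdist_ge0.
Qed.

Lemma measure_setC_null {d : measure_display} {T : measurableType d}
    {R : realType} (mu : {measure set T -> \bar R}) (E : set T) :
  measurable E -> mu setT = 1%E -> mu E = 1%E -> mu (~` E) = 0%E.
Proof.
move=> mE mT mE1; have mToo : (mu setT < +oo)%E by rewrite mT ltry.
have E0 : (mu setT - mu (setT `&` E) = 0)%E by rewrite setTI mT mE1 subee.
by rewrite -setTD; exact: etrans (measureD measurableT mE mToo) E0.
Qed.

Lemma coupling_diag {R : realType} {S : pmetricType R} {d : measure_display}
    {Omega : measurableType d} (X Y : {mfun Omega >-> borel S})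
    (P : R.-pker (borel S * borel S) ~> Omega) (x : S) (f : R -> R) :
    separable S -> P (x, x) [set w | X w = Y w] = 1%E ->
    measurable_fun `[(0 : R), +oo[ f -> f 0 = 0 ->
  (\int[P (x, x)]_w (f (@mdist R S (X w) (Y w)))%:E)%E = 0%E.
Proof.
move=> sS XY1 mf f0; have mD := measurable_mdist X Y sS.
pose E := [set w | @mdist R S (X w) (Y w) = 0].
have mE : measurable E.
  have -> : E = (fun w => @mdist R S (X w) (Y w)) @^-1` [set 0] by [].
  by rewrite -[X in measurable X]setTI; exact: mD.
have E1 : P (x, x) E = 1%E.
  rewrite -XY1; congr (P (x, x) _); apply/seteqP; split => w /=.
    by move=> /mdist_positivity.
  by rewrite /E/= => ->; rewrite mdistxx.
rewrite -[RHS](@integral0 _ _ _ (P (x, x)) setT).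
apply: ae_eq_integral => //.
  apply/measurable_EFinP; apply: measurable_comp mf mD => //.
  by move=> _ [w _ <-] /=; rewrite in_itv/= andbT mdist_ge0.
exists (~` E); split.
- exact: measurableC.
- exact: measure_setC_null mE (@prob_kernel _ _ _ _ _ P (x, x)) E1.
- by move=> w /=; apply: contra_not => Ew _; rewrite Ew f0.
Qed.

(** The infimum of the ratio [alpha / r] is positive, so the denominator in the
    supremum is a positive real at the distance considered and the quotient can
    be cleared; the supremum is the real number [c - 1]. *)
Lemma sup_drift_ratio_bound {R : realType} {S : pmetricType R}
    {d : measure_display} {Omega : measurableType d}
    (X Y : {mfun Omega >-> borel S})
    (P : R.-pker (borel S * borel S) ~> Omega) (Psi : R -> R)
    (l0 r1 c kappa b e : R) (x y : S) :
    0 < kappa -> (kappa%:E <= inf_alpha_ratio X Y P l0 r1)%E ->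
    c%:E = (sup_drift_ratio X Y P Psi l0 r1 + 1)%E ->
    0 < mdist x y <= r1 ->
    0 < Psi^`()%classic (mdist x y + l0) ->
    beta X Y P x y = b%:E -> alpha X Y P l0 x y = e%:E ->
  kappa * mdist x y <= e /\
  2 * b <= (c - 1) * (Psi^`()%classic (mdist x y + l0) * e).
Proof.
set r := mdist x y => k0 kle hc rI m0 Eb Ee; set m := Psi^`()%classic _ in m0 *.
have /andP[r0 rr1] := rI.
have rD : @distances R S r1 r by split=> //; exists x, y.
have ai_le : (alpha_inf X Y P l0 r <= e%:E)%E.
  by rewrite -Ee; apply: ereal_inf_lbound; exists (x, y).
have k_le : ((kappa * r)%:E <= alpha_inf X Y P l0 r)%E.
  have : (kappa%:E <= alpha_inf X Y P l0 r / r%:E)%E.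
    by apply: le_trans kle _; apply: ereal_inf_lbound; exists r.
  by rewrite inver gt_eqF// lee_pdivlMr// EFinM.
have [a Ea] : exists a, alpha_inf X Y P l0 r = a%:E.
  by move: ai_le k_le; case: (alpha_inf X Y P l0 r) => [a||]//; exists a.
move: ai_le k_le; rewrite Ea !lee_fin => ae ka.
have a0 : 0 < a by apply: lt_le_trans ka; rewrite mulr_gt0.
split; first exact: le_trans ae.
have bs : (b%:E <= beta_sup X Y P r)%E.
  by rewrite -Eb; apply: ereal_sup_ubound; exists (x, y).
have sle : (2%:E * maxe (beta_sup X Y P r) 0 / (m%:E * alpha_inf X Y P l0 r)
    <= sup_drift_ratio X Y P Psi l0 r1)%E.
  rewrite /sup_drift_ratio le_max; apply/orP; right.
  by apply: ereal_sup_ubound; exists r.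
have [s0 c1] : (0 <= sup_drift_ratio X Y P Psi l0 r1)%E /\
    sup_drift_ratio X Y P Psi l0 r1 = (c - 1)%:E.
  split; first by rewrite /sup_drift_ratio le_max lexx.
  by rewrite EFinB hc addeK.
move: sle s0; rewrite c1 Ea -EFinM inver gt_eqF ?mulr_gt0// lee_fin => sle c1_ge0.
have : ((2 * b)%:E <= ((c - 1) * (m * a))%:E)%E.
  move: sle; rewrite lee_pdivrMr ?mulr_gt0// -EFinM; apply: le_trans.
  by rewrite EFinM lee_pmul2l// le_max bs.
rewrite lee_fin => /le_trans; apply.
by rewrite ler_wpM2l// ler_wpM2l// ltW.
Qed.

(** * Contraction in the three ranges of distances *)

(** The term [c * m * b' / 2] exceeds the bound of the drift by [m * b' / 2],
    and [b'] is at least [kappa * f]. *)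
Lemma short_contraction {R : realType} (f r e e1 m m1 c kappa b b' : R) :
    0 <= f <= r -> 0 < kappa -> kappa * r <= b' ->
    2 * b <= (c - 1) * (m * b') -> 0 <= e1 <= e -> 0 <= m1 <= m ->
  f + e * b - e * c * m / 2 * b' <= (1 - e1 * m1 * kappa / 2) * f.
Proof.
move=> /andP[f0 fr] k0 kr br /andP[e10 e1e] /andP[m10 m1m].
have kf : kappa * f <= b' by apply: le_trans kr; rewrite ler_pM2l.
have kf0 : 0 <= kappa * f by rewrite mulr_ge0// ltW.
have em : e1 * m1 <= e * m by rewrite ler_pM.
have : e1 * m1 * (kappa * f) <= e * m * b' by rewrite ler_pM// mulr_ge0.
have := ler_wpM2l (le_trans e10 e1e) br; lra.
Qed.

(** Here [D] is the slope at [r] and [D1] a lower bound of it; the drift costs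
    at least [c0 * r * D1 >= c0 * D1 * f]. *)
Lemma middle_contraction {R : realType} (f r c0 D D1 b : R) :
    0 <= f <= r -> 0 < c0 -> 0 <= D1 <= D -> b <= - c0 * r ->
  f + D * b <= (1 - c0 * D1) * f.
Proof.
move=> /andP[f0 fr] c00 /andP[D10 D1D] br.
have Dr : D1 * f <= D * r by rewrite ler_pM.
have := ler_wpM2l (ltW c00) Dr.
have := ler_wpM2l (le_trans D10 D1D) br; lra.
Qed.

(** After inserting [b <= - c0 * r] the terms with [D] can only help, and those
    with [H] add up to at most [q * h].  The loss [(1 - q) * h] is a fixed
    fraction of [G + h] because [G / h <= g / h0]. *)
Lemma far_contraction {R : realType} (G D H h h0 g r v q c0 b : R) :
    0 <= G <= g -> 0 <= D -> 0 <= H -> 0 < h0 <= h -> 0 <= r <= v -> 0 < v ->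
    0 <= q < 1 -> 0 < c0 -> b <= - c0 * r -> (1 - c0) * H <= q * h ->
  (G + r / v * H) + (D + H / v) * b <=
    (1 - (1 - q) / (1 + g / h0)) * (G + h).
Proof.
move=> /andP[G0 Gg] D0 H0 /andP[h00 h0h] /andP[r0 rv] v0 /andP[q0 q1] c00 br Hh.
have g0 : 0 <= g by exact: le_trans Gg.
have h_gt0 : 0 < h by exact: lt_le_trans h0h.
have Hhr : (1 - c0) * H * (r / v) <= q * h.
  apply: (@le_trans _ _ (q * h * (r / v))).
    by rewrite ler_wpM2r// divr_ge0// ltW.
  by rewrite ler_piMr ?(mulr_ge0 q0 (ltW h_gt0))// ler_pdivrMr// mul1r.
have u0 : 0 <= D + H / v by rewrite addr_ge0// divr_ge0// ltW.
have uE : (D + H / v) * (- c0 * r) = - (c0 * r * D) - c0 * H * (r / v) by ring.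
have := ler_wpM2l u0 br; rewrite uE => ub.
have cD0 : 0 <= c0 * r * D by rewrite !mulr_ge0// ltW.
have epsE : (1 - q) / (1 + g / h0) * (G + h) <= (1 - q) * h.
  rewrite mulrAC ler_pdivrMr; last first.
    by rewrite ltr_pwDl// divr_ge0// ltW.
  rewrite -mulrA ler_pM2l ?subr_gt0// mulrDr mulr1 addrC lerD2l.
  apply: le_trans Gg _; rewrite mulrCA ler_peMr//.
  by rewrite ler_pdivlMr// mul1r.
lra.
Qed.

(** * The contraction theorem *)

Theorem theorem2p7 (R : realType) (S : pmetricType R) (hS : separable S)
  (d : measure_display) (Omega : measurableType d)
  (kp : R.-pker borel S ~> borel S)
  (X Y : {mfun Omega >-> borel S})
  (P : R.-pker (borel S * borel S) ~> Omega)
  (hcoupling : markov_coupling X Y P kp)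
  (hdiag : forall x : S, P (x, x) [set w | X w = Y w] = 1%E)
  (l : R) (hl : 0 < l)
  (hjump : forall x y : S,
    {ae P (x, y), forall w, @mdist R S (X w) (Y w) <= mdist x y + l})
  (Psi : R -> R)
  (Psi_ge0 : forall r, 0 <= r -> 0 <= Psi r)
  (Psi_continuous : {within `[0, +oo[, continuous Psi})
  (Psi_derivable : forall r, 0 < r -> derivable Psi r 1)
  (Psi'_derivable : forall r, 0 < r -> derivable Psi^`() r 1)
  (Psi''_continuous : {in `]0, +oo[, continuous Psi^`()^`()})
  (Psi0 : Psi 0 = 0)
  (Psi'_gt0 : forall r, 0 < r -> 0 < Psi^`() r)
  (Psi''_le0 : forall r, 0 < r -> Psi^`()^`() r <= 0)
  (Psi''_nonincreasing : forall r s, 0 < r -> r <= s ->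
    Psi^`()^`() s <= Psi^`()^`() r)
  (l0 r1 c0 : R) (hl0 : 0 < l0) (hr1 : 0 < r1) (hc0 : 0 < c0)
  (hr1l : l + 1 <= r1)
  (hb1 : (0 < inf_alpha_ratio X Y P l0 r1)%E)
  (hb2 : ((sup_drift_ratio X Y P Psi l0 r1 + 1) * (Psi l0)%:E
            <= (ln 2)%:E)%E)
  (hb3 : forall r, r1 < r -> (beta_sup X Y P r <= (- c0 * r)%:E)%E)
  (p : R) (hp : 2 < p)
  (c : R) (hc : c%:E = (sup_drift_ratio X Y P Psi l0 r1 + 1)%E)
  (k : R)
  (hk : 1 + Num.max (2 * l * expR (c * l) / (c0 * (r1 + l0)))
                    (4 `^ p * l / (c0 * (r1 + l0))) <= k)
  (A : R)
  (hA : A = (k * (r1 + l0)) `^ (2 - p) / (p * (p - 1)) * c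
            * expR (- c * (Psi (r1 + l0) + k * (r1 + l0)))) :
  let rho (x y : S) := f4 Psi c A p (r1 + l0) (mdist x y) in
  exists cstar : R, 0 < cstar < 1 /\
    forall x y : S,
      (\int[P (x, y)]_w (rho (X w) (Y w))%:E
         <= ((1 - cstar) * rho x y)%:E)%E.
Proof.
move=> rho.
set a := r1 + l0 in hk hA rho *; set s := sup_drift_ratio _ _ _ _ _ _ in hb2 hc.
have c1 : 1 <= c by rewrite -lee_fin hc leeDr// /s /sup_drift_ratio le_max lexx.
have c_gt0 : 0 < c := lt_le_trans ltr01 c1.
have cPl0 : c * Psi l0 <= ln 2 by move: hb2; rewrite -hc -EFinM lee_fin.
have r1a : r1 < a by rewrite ltrDl.
have a0 : 0 < a := lt_trans hr1 r1a.
have lr1 : l <= r1 by apply: le_trans hr1l; rewrite lerDl.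
have la : l < a := le_lt_trans lr1 r1a.
(* The second term of the maximum in the lower bound of [k]. *)
have k4 : 4 `^ p * l <= c0 * ((k - 1) * a).
  have : 4 `^ p * l / (c0 * a) <= k - 1.
    by rewrite lerBrDl; apply: le_trans hk; rewrite lerD2l le_max lexx orbT.
  by rewrite ler_pdivrMr ?mulr_gt0// mulrCA.
have k1a0 : 0 < (k - 1) * a.
  rewrite -(pmulr_rgt0 _ hc0); apply: lt_le_trans k4.
  by rewrite mulr_gt0// powR_gt0.
have kaE : k * a = (k - 1) * a + a by rewrite mulrBl mul1r subrK.
have ka : a < k * a by rewrite kaE ltrDr.
have ka0 : 0 < k * a := lt_trans a0 ka.
have p1 : 1 < p by apply: lt_trans hp; rewrite ltr1n.
have p0 : 0 < p := lt_trans ltr01 p1.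
have A0 : 0 < A.
  rewrite hA !mulr_gt0 ?expR_gt0 ?powR_gt0 ?invr_gt0//.
  by rewrite mulr_gt0// subr_gt0.
have P'0 r : 0 < r -> 0 <= Psi^`()%classic r by move=> /Psi'_gt0/ltW.
have Pa := derive_antitone Psi'_derivable Psi''_le0.
have sgA : supergradient (f4_slope Psi c A p a) (f4 Psi c A p a)
    `[0, a + k * a]%R.
  apply: f4_supergradient => //; try exact: ltW.
  by move=> u uI; exact: amplitude_tail uI hA.
have sg0 v : 0 <= v ->
    supergradient (f4_slope Psi c 0 p a) (f4 Psi c 0 p a) `[0, v]%R.
  by apply: capped_supergradient => //; exact: ltW.
have G_ge0 t : 0 <= t -> 0 <= f4 Psi c 0 p a t.
  by apply: capped_ge0 => //; exact: ltW.
have G_le t : a <= t -> f4 Psi c 0 p a t <= a + 1.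
  by apply: capped_le => //; exact: ltW.
set f := f4 Psi c A p a in sgA *; set G := f4 Psi c 0 p a in sg0 G_ge0 G_le *.
set D := f4_slope Psi c A p a in sgA *; set D0 := f4_slope Psi c 0 p a in sg0 *.
have D_ge0 t : 0 <= D t by apply: f4_slope_ge0; exact: ltW.
have D0_ge0 t : 0 <= D0 t by apply: f4_slope_ge0 => //; exact: ltW.
have f0 : f 0 = 0 by apply: f4_0; exact: ltW.
have f_le t : 0 <= t <= a + k * a -> 0 <= f t <= t.
  move=> tI; apply: (supergradient_from0 sgA f0 _ tI (D_ge0 t)).
  by rewrite /D /f4_slope ltW// Psi0 mulr0 expR0.
have fE t : a < t -> f t = G t + A * (t - a) `^ p.
  by move=> at_; rewrite /f f4_split// lt_geF.
have f_ge0 t : 0 <= t -> 0 <= f t.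
  move=> t0; have [ta|at_] := leP t a.
    have /andP[] // : 0 <= f t <= t.
    by apply: f_le; rewrite t0 (le_trans ta)// lerDl ltW.
  by rewrite fE// addr_ge0 ?G_ge0// mulr_ge0 ?powR_ge0// ltW.
have mf : measurable_fun `[(0 : R), +oo[ f by exact: f4_measurable (ltW a0).
have [kappa kappa0 kle] : exists2 kappa : R, 0 < kappa &
    (kappa%:E <= inf_alpha_ratio X Y P l0 r1)%E.
  move: hb1; case: (inf_alpha_ratio _ _ _ _ _) => [q||]//.
    by rewrite lte_fin => q0; exists q.
  by move=> _; exists 1 => //; rewrite leey.
(* Contraction rates for [r <= r1], [r1 < r <= k * a] and [k * a < r]. *)
pose eps1 := expR (- c * Psi r1) * Psi^`()%classic a * kappa / 2.
pose eps2 := c0 * D (k * a).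
pose h0 := A * ((k - 1) * a) `^ p.
pose q := expR (- (c0 / 2)).
pose eps3 := (1 - q) / (1 + (a + 1) / h0).
have eps1_gt0 : 0 < eps1.
  by rewrite /eps1 divr_gt0// !mulr_gt0 ?expR_gt0 ?Psi'_gt0.
have eps2_gt0 : 0 < eps2.
  rewrite mulr_gt0// /D f4_slope_ge ?ltW//.
  by rewrite ltr_wpDl ?mulr_gt0 ?expR_gt0// !mulr_ge0 ?powR_ge0// ltW.
have h0_gt0 : 0 < h0 by rewrite mulr_gt0// powR_gt0.
have q1 : q < 1 by rewrite /q expR_lt1 oppr_lt0 divr_gt0.
have eps3_gt0 : 0 < eps3.
  by rewrite divr_gt0 ?subr_gt0// addr_gt0// divr_gt0// addr_gt0.
(* The entry [2^-1] only keeps the constant below [1]. *)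
exists (Num.min 2^-1 (Num.min eps1 (Num.min eps2 eps3))); split.
  rewrite !lt_min eps1_gt0 eps2_gt0 eps3_gt0/= invr_gt0 ltr0n/=.
  by rewrite gt_min invf_lt1// ltr1n.
set cstar := Num.min _ _; move=> x y.
have weaken (eps : R) (E : \bar R) : cstar <= eps ->
    (E <= ((1 - eps) * f (mdist x y))%:E)%E ->
    (E <= ((1 - cstar) * f (mdist x y))%:E)%E.
  move=> le_eps /le_trans; apply; rewrite lee_fin ler_wpM2r ?lerD2l ?lerN2//.
  by rewrite f_ge0// mdist_ge0.
have cs1 : cstar <= eps1 by rewrite /cstar !ge_min lexx !orbT.
have cs2 : cstar <= eps2 by rewrite /cstar !ge_min lexx !orbT.
have cs3 : cstar <= eps3 by rewrite /cstar !ge_min lexx !orbT.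
rewrite /rho -/f.
have step u v w := @coupling_step R S d Omega X Y P x y f l l0 u v w hS
  (hjump x y) (ltW hl) mf.
have f_ge0' t : 0 <= t <= mdist x y + l -> 0 <= f t.
  by move=> /andP[t0 _]; exact: f_ge0.
have r0 : 0 <= mdist x y by exact: mdist_ge0.
set r := mdist x y in step weaken r0 f_ge0' *.
(* At distance [0] the coupling keeps both copies together. *)
have [r_eq0|r_neq0] := eqVneq r 0.
  have xy : x = y by apply: (@mdist_positivity R S).
  by rewrite r_eq0 f0 mulr0 -xy (coupling_diag hS (hdiag x) mf f0).
have r_gt0 : 0 < r by rewrite lt_neqAle eq_sym r_neq0.
have rDl : 0 < r + l by rewrite addr_gt0.
have [rr1|r1r] := leP r r1.
- apply: (weaken _ _ cs1).
  have rl0 : 0 < r + l0 by rewrite addr_gt0.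
  have rl : r + l <= a + k * a by apply: lerD; apply: ltW;
    [exact: le_lt_trans r1a|exact: lt_trans ka].
  have ra : r <= a + k * a by apply: le_trans rl; rewrite lerDl ltW.
  have rl0a : r + l0 <= a by rewrite lerD2r.
  have fle t : 0 <= t <= r + l -> f t <= f r + expR (- c * Psi r) * (t - r)
      - expR (- c * Psi r) * c * Psi^`()%classic (r + l0) / 2
        * (2^-1 * ((t - r) ^+ 2 * (t < r + l0)%R%:R)).
    move=> /andP[t0 tr]; apply: (f4_second_order (b := a + k * a)) => //.
    by rewrite t0 (le_trans tr).
  have [b [b' [Eb Eb' Ef]]] := step _ _ _ f_ge0' fle.
  apply: le_trans Ef _; rewrite lee_fin.
  have rI : 0 < r <= r1 by rewrite r_gt0.
  have [kb br] := sup_drift_ratio_bound kappa0 kle hc rI (Psi'_gt0 _ rl0) Eb Eb'.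
  apply: (short_contraction (r := r)) => //.
  + by apply: f_le; rewrite r0.
  + rewrite expR_ge0/= ler_expR !mulNr lerN2 ler_pM2l//.
    exact: nondecreasing_derive.
  + by rewrite P'0//= Pa.
have b_le b : beta X Y P x y = b%:E -> b <= - c0 * r.
  move=> Eb; rewrite -lee_fin -Eb; apply: le_trans (hb3 _ r1r).
  by apply: ereal_sup_ubound; exists (x, y).
have [rka|kar] := leP r (k * a).
- apply: (weaken _ _ cs2).
  have rl : r + l <= a + k * a by rewrite addrC lerD// ltW.
  have ra : r <= a + k * a by apply: le_trans rl; rewrite lerDl ltW.
  have rI : r \in `[0, a + k * a]%R by rewrite in_itv/= r0.
  have kaI : k * a \in `[0, a + k * a]%R.
    by rewrite in_itv/= (ltW ka0)/= lerDr ltW.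
  have fle t : 0 <= t <= r + l -> f t <= f r + D r * (t - r)
      - 0 * (2^-1 * ((t - r) ^+ 2 * (t < r + l0)%R%:R)).
    move=> /andP[t0 tr]; rewrite mul0r subr0 -lerBlDl; apply: sgA => //.
    by rewrite in_itv/= t0 (le_trans tr).
  have [b [b' [/b_le b_ler _ Ef]]] := step _ _ _ f_ge0' fle.
  apply: le_trans Ef _; rewrite lee_fin mul0r subr0.
  apply: (middle_contraction (r := r)) => //.
  + by apply: f_le; rewrite r0.
  + by rewrite D_ge0/=; exact: (supergradient_antitone sgA).
- apply: (weaken _ _ cs3).
  have ar : a < r := lt_trans ka kar.
  have k1ar : (k - 1) * a <= r - a by rewrite lerBrDr -kaE ltW.
  have ra0 : 0 <= r - a by rewrite subr_ge0 ltW.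
  have rI : 0 <= r <= r + l by rewrite r0 lerDl ltW.
  set H := A * (r + l - a) `^ p.
  have fle t : 0 <= t <= r + l -> f t <= (G r + r / (r + l) * H)
      + (D0 r + H / (r + l)) * (t - r)
      - 0 * (2^-1 * ((t - r) ^+ 2 * (t < r + l0)%R%:R)).
    move=> tI; rewrite mul0r subr0; apply: f4_chord => //; try exact: ltW.
    by apply: sg0; exact: ltW.
  have [b [b' [/b_le b_ler _ Ef]]] := step _ _ _ f_ge0' fle.
  apply: le_trans Ef _; rewrite lee_fin mul0r subr0 (fE _ ar).
  apply: far_contraction b_ler _ => //.
  + by rewrite G_ge0// G_le// ltW.
  + by rewrite mulr_ge0 ?powR_ge0// ltW.
  + rewrite h0_gt0/= ler_pM2l// ge0_ler_powR ?nnegrE//; exact: ltW.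
  + by rewrite expR_ge0.
  + have : (1 - c0) * (r - a + l) `^ p <= q * (r - a) `^ p.
      apply: powR_excess => //; first exact: ltW.
      by apply: le_trans k4 _; rewrite ler_pM2l.
    by rewrite -(ler_pM2l A0) /H (addrAC r) mulrCA (mulrCA A).
Qed.
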